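(* For every positive integer $N$, the map $\Phi_N$ restricts to a bijection from $\mathcal{ROP}_N$ (the $N$-party reduced odd partitions) onto $\mathcal{RL}_N$ (the reduced lecture hall partitions of width $N$).
   Context: A partition is a finite weakly decreasing sequence $\lambda=(\lambda_1\ge\lambda_2\ge\dots\ge\lambda_\ell>0)$ of positive integers (the empty partition $\emptyset$ is allowed); $\ell(\lambda)=\ell$ is its length, and $m_i(\lambda)$ the multiplicity of $i$ as a part. Partitions are identified with sequences obtained by appending zeros. Finitely supported integer sequences are added and subtracted entrywise ($+$, $-$). $\lambda\sqcup\mu$ is the partition whose multiset of parts is the union (multiplicities added) of those of $\lambda$ and $\mu$; $(a)^m$ is the partition with $m$ parts equal to $a$. Lecture hall partitions. For a positive integer $N$, $\mathcal{L}_N$ is the set of partitions $\mu$ with $\ell(\mu)\le N$ and $$\frac{\mu_1}{N}\ge\frac{\mu_2}{N-1}\ge\dots\ge\frac{\mu_{\ell(\mu)}}{N-\ell(\mu)+1}$$ ($\emptyset\in\mathcal{L}_N$). A partition $\mu\in\mathcal{L}_N$ is reduced if for every $i$ with $1\le i\le \ell(\mu)$ the sequence obtained from $\mu$ by replacing $\mu_i$ with $\mu_i-(N-i+1)$ (leaving other entries unchanged) is not in $\mathcal{L}_N$; trailing zeros are deleted, and a sequence that is not a partition is not in $\mathcal{L}_N$. $\mathcal{RL}_N$ is the set of reduced elements of $\mathcal{L}_N$. Odd partitions. $\mathcal{OP}_N$ is the set of partitions all of whose parts are odd and at most $2N$, and $\mathcal{ROP}_N=\{\lambda\in\mathcal{OP}_N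 : m_{2k-1}(\lambda)\le N-k \text{ for all } 1\le k\le N\}$. Trapezoids. For $n\ge k\ge1$, $[\Diamond]_{n,k}=(n,n-1,\dots,n-2k+2)$ if $k\le n/2$ and $[\Diamond]_{n,k}=(n,n-1,\dots,2k-n-1)$ if $k>n/2$ (a trailing $0$ is dropped); $[\Diamond]_{k-1,k}=\emptyset$. For $i,k\ge1$ put $A_{i,k}=[\Diamond]_{k+i-1,k}-[\Diamond]_{k+i-2,k}$, an integer sequence. The map $\Phi_N$ and the counter $I$. For $\lambda\in\mathcal{OP}_N$ an integer sequence $\Phi_N(\lambda)$ and a counter $I(\lambda)=[I_1(\lambda),\dots,I_N(\lambda)]$ of nonnegative integers are defined recursively by inserting the parts of $\lambda$ in weakly decreasing order. Start: $\Phi_N(\emptyset)=\emptyset$, $I(\emptyset)=[0,\dots,0]$. Step: if $2k-1$ ($1\le k\le N$) is at most every part of $\lambda$, let $i(\lambda)=\min\{j: I_j(\lambda)=0\}$; then $\Phi_N(\lambda\sqcup(2k-1))=\Phi_N(\lambda)+A_{i(\lambda),k}$, and $I(\lambda\sqcup(2k-1))$ is obtained from $I(\lambda)$ by decreasing each $I_j(\lambda)$ with $j<i(\lambda)$ by $1$, setting the $i(\lambda)$-th entry equal to $N-k-i(\lambda)+1$, and leaving the entries with $j>i(\lambda)$ unchanged. *)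

(* Defs.v *)
From mathcomp Require Import all_boot all_order all_algebra.
From mathcomp Require Import boolp classical_sets functions.

Set Implicit Arguments.
Unset Strict Implicit.
Unset Printing Implicit Defensive.

Import Order.TTheory GRing.Theory Num.Theory.

Local Open Scope nat_scope.
Local Open Scope ring_scope.
Local Open Scope classical_set_scope.

(* Positions in sequences are 0-based: the i-th entry of the text sits at
   position i - 1. *)

Definition is_partition (s : seq nat) : bool :=
  sorted geq s && all (fun p => (0 < p)%N) s.

(* Integer sequences, with the pointwise zmodType structure of functions.
   Padding with zeros identifies a finite sequence with an element of
   [nat -> int] and makes trailing zeros irrelevant. *)
Definition zseq (s : seq nat) : nat -> int := fun j => (nth 0%N s j)%:Z.

Definition lecture_hall (N : nat) : set (seq nat) :=
  [set mu | [/\ is_partition mu, (size mu <= N)%N &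
     forall i : nat, (i.+1 < size mu)%N ->
       (nth 0%N mu i.+1)%:R / (N - i.+1)%:R
         <= (nth 0%N mu i)%:R / (N - i)%:R :> rat]].

Definition lower_entry (N : nat) (mu : seq nat) (i : nat) : nat -> int :=
  fun j => if j == i then zseq mu j - (N - i)%:Z else zseq mu j.

(* An integer sequence belongs to the set of lecture hall partitions when it is
   the zero-padding of one. *)
Definition reduced_lecture_hall (N : nat) : set (seq nat) :=
  [set mu | lecture_hall N mu /\
     forall i : nat, (i < size mu)%N ->
       ~ (zseq @` lecture_hall N) (lower_entry N mu i)].

Definition odd_partition (N : nat) : set (seq nat) :=
  [set la | is_partition la /\ all (fun p => odd p && (p <= 2 * N)%N) la].

Definition reduced_odd_partition (N : nat) : set (seq nat) :=
  [set la | odd_partition N la /\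
     forall k : nat, (1 <= k <= N)%N -> (count_mem (2 * k - 1)%N la <= N - k)%N].

(* a, a - 1, ..., b *)
Definition descending (a b : nat) : seq nat := rev (index_iota b a.+1).

(* The possible trailing 0 is kept here; [zseq] forgets it. The case [n < k]
   is only used for [n = k - 1]. *)
Definition trapezoid (n k : nat) : seq nat :=
  if (n < k)%N then [::]
  else if (2 * k <= n)%N then descending n (n + 2 - 2 * k)
  else descending n (2 * k - n - 1).

Definition trap_diff (i k : nat) : nat -> int :=
  zseq (trapezoid (k + i - 1) k) - zseq (trapezoid (k + i - 2) k).

(* The 1-based index of the first zero of the counter. A zero always exists
   among the N entries: after inserting parts >= 2k - 1 one has
   I_j <= max(0, N - k - j + 1), so [first_zero I] <= N - k + 1, and the truncated
   subtraction in [insert_counter] is never truncating. *)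
Definition first_zero (I : seq nat) : nat := (index 0%N I).+1.

Definition insert_counter (N k : nat) (I : seq nat) : seq nat :=
  [seq (if (j < first_zero I)%N then nth 0%N I j.-1 - 1
        else if j == first_zero I then N + 1 - k - first_zero I
        else nth 0%N I j.-1)%N | j <- iota 1 N].

Definition Phi_step (N : nat) (st : (nat -> int) * seq nat) (p : nat) :
    (nat -> int) * seq nat :=
  let k := p.+1./2 in
  (st.1 + trap_diff (first_zero st.2) k, insert_counter N k st.2).

(* A partition lists its parts in weakly decreasing order, so inserting the
   parts in that order is a left fold. *)
Definition Phi (N : nat) (la : seq nat) : nat -> int :=
  (foldl (Phi_step N) (0, nseq N 0%N) la).1.

(* Main.v *)
Require Import Defs.
From mathcomp Require Import all_boot all_order all_algebra.
From mathcomp Require Import boolp classical_sets functions.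
From mathcomp Require Import zify ring.

(* Induction on the width. A partition la of width M + 1 is la' + 2 (all parts of
   a partition la' of width M increased by 2) together with m parts equal to 1.
   The counters evolve in the same way for la' in width M and for la' + 2 in
   width M + 1, and comparing the two insertion processes shows that, with
   f = Phi_M(la') and g = Phi_{M+1}(la), the tail (g_2, g_3, ...) is obtained from
   f by keeping the odd-numbered entries and reflecting every even-numbered entry
   in the interval of values that its two neighbours allow. The reflection is an
   involution that preserves reducedness. The entry g_1 is m plus the least value
   allowed by g_2, and a reduced sequence allows exactly the M + 1 values
   0 <= m <= M. The counter enters only through the invariant
   f_{2j-1} = T_j (M - 2j + 2) - I_j with 0 <= I_j < M - 2j + 2, which says that the
   number T_j of parts 2k - 1 with k >= j inserted at index j is f_{2j-1} / (M - 2j + 2)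
   rounded up. It holds while the inserted parts are at least 2j - 1, and smaller
   parts change neither f_{2j-1} nor T_j. *)

Set Implicit Arguments.
Unset Strict Implicit.

Import Order.TTheory GRing.Theory Num.Theory.
Local Open Scope classical_set_scope.
Local Open Scope ring_scope.

(** * Entries of trapezoid differences and of counters *)

Lemma nth_descending a b j :
  nth 0%N (descending a b) j = (if j + b <= a then a - j else 0)%N.
Proof.
rewrite /descending /index_iota.
case: (ltnP j (a.+1 - b)) => hj.
  rewrite nth_rev size_iota // nth_iota; [case: ifP; lia | lia].
by rewrite nth_default ?size_rev ?size_iota //; case: ifP => //; lia.
Qed.

(** When the top grows from [k + i - 1] to [k + i], the existing nonzero entries,
    [min(2 i, 2 k - 1)] of them, rise by 1; for [i < k] the entries [k - i] and [k - i - 1] are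
    appended. *)
Lemma trap_diffE i k j : (0 < k)%N ->
  trap_diff i.+1 k j =
    if odd j then
      (if j./2 < i then (j./2.+1 < k : nat)
       else if j./2 == i then k - j./2 - 1 else 0)%N%:Z
    else
      (if j./2 < i then (j./2 < k : nat)
       else if j./2 == i then k - j./2 else 0)%N%:Z.
Proof.
move=> k0; rewrite /trap_diff !fctE /zseq.
have -> : (k + i.+1 - 1 = k + i)%N by lia.
have -> : (k + i.+1 - 2 = k + i - 1)%N by lia.
rewrite /trapezoid.
rewrite !(fun_if (fun s => nth 0%N s j)) !nth_descending nth_nil.
have := odd_double_half j; case: (odd j) => /= hj.
  by repeat case: ifP; lia.
by repeat case: ifP; lia.
Qed.

Lemma nth_index_zero (I : seq nat) : nth 0%N I (index 0%N I) = 0%N.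
Proof.
case: (boolP (0%N \in I)) => [/nth_index -> //|].
by rewrite -index_mem -leqNgt => h; rewrite nth_default.
Qed.

Lemma index_zero_le (I : seq nat) j : nth 0%N I j = 0%N -> (index 0%N I <= j)%N.
Proof.
move=> hj; rewrite leqNgt; apply/negP => /(before_find 0%N) /=.
by rewrite hj.
Qed.

Lemma eq_index_zero (I J : seq nat) :
  nth 0%N I =1 nth 0%N J -> index 0%N I = index 0%N J.
Proof.
move=> h; apply/eqP; rewrite eqn_leq !index_zero_le ?h ?nth_index_zero //.
by rewrite -h nth_index_zero.
Qed.

Lemma nth_insert_counter N k I j :
  nth 0%N (insert_counter N k I) j =
  (if j < N then
     if j < index 0 I then nth 0 I j - 1
     else if j == index 0 I then N - k - j else nth 0 I j
   else 0)%N.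
Proof.
rewrite /insert_counter /first_zero.
case: (ltnP j N) => hj; last by rewrite nth_default // size_map size_iota.
rewrite (nth_map 0%N) ?size_iota // nth_iota // add1n ltnS eqSS.
by repeat case: ifP => //; lia.
Qed.

(** * Insertion in widths [M] and [M + 1] compared *)

(* The states [s] and [t] are those of the insertion process for width [M] on
   parts at least [2 k - 1], and for width [M + 1] on the same parts increased
   by 2; [T j] is the number of parts [2 k' - 1] with [k' > j] inserted at the
   0-based index [j]. *)
Definition coupled (M k : nat) (T : nat -> int)
    (s t : (nat -> int) * seq nat) : Prop :=
  [/\ nth 0%N t.2 =1 nth 0%N s.2,
      forall j, (nth 0 s.2 j <= M - k - j)%N,
      forall j, t.1 j.*2.+1 = s.1 j.*2,
      t.1 0%N = s.1 0%N + T 0%N /\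
      forall j, t.1 j.*2.+2 + s.1 j.*2.+1
                = s.1 j.*2 - T j + (s.1 j.*2.+2 + T j.+1) &
      forall j, exists2 r : nat,
        s.1 j.*2 = T j * (M - j.*2)%N%:Z - r%:Z &
        (if j.*2 < M then (r < M - j.*2) && ((j < k) ==> (r == nth 0 s.2 j))
         else (r == 0) && (T j == 0))%N].

(** Lowering the threshold relaxes the counter bound and frees the remainders [r] at [k' <= j < k]
    from the counter. *)
Lemma coupled_le M k k' T s t :
  (k' <= k)%N -> coupled M k T s t -> coupled M k' T s t.
Proof.
move=> kk [h1 h2 h3 h4 h5]; split=> // j; first by have := h2 j; lia.
have [r e hr] := h5 j; exists r => //; move: hr; case: ifP => //; lia.
Qed.

Lemma coupled_step M k T s t : (0 < k <= M)%N -> coupled M k T s t ->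
  exists T', coupled M k T' (Phi_step M s (2 * k - 1))
                            (Phi_step M.+1 t (2 * k + 1)).
Proof.
move=> /andP[k0 kM] [h1 h2 h3 [h40 h4] h5].
pose i := index 0%N s.2.
have ti : index 0%N t.2 = i by exact: eq_index_zero.
have hi0 : nth 0%N s.2 i = 0%N by exact: nth_index_zero.
(* The counter bound at position [M - k] is 0. For [j <= i] and [j < k] this also gives
   [2 j < M]. *)
have iM : (i <= M - k)%N by apply: index_zero_le; have := h2 (M - k)%N; lia.
have hlt j : (j < i)%N -> (0 < nth 0%N s.2 j)%N.
  by move=> ji; rewrite lt0n; apply/eqP => /index_zero_le; rewrite -/i; lia.
have e1 : ((2 * k - 1).+1./2 = k)%N by lia.
have e2 : ((2 * k + 1).+1./2 = k.+1)%N by lia.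
(* For [k <= i] the entry at [2 i] gains nothing, so [T] must not grow. *)
exists (fun j => T j + ((j == i) && (j < k))%N%:Z).
rewrite /Phi_step /first_zero e1 e2 ti -/i.
have ev (j : nat) : j.*2./2 = j by rewrite doubleK.
have od (j : nat) : j.*2.+1./2 = j by lia.
have hs j : (s.1 + trap_diff i.+1 k) j = s.1 j + trap_diff i.+1 k j by [].
have ht j : (t.1 + trap_diff i.+1 k.+1) j = t.1 j + trap_diff i.+1 k.+1 j by [].
split=> /=.
- move=> j; rewrite !nth_insert_counter ti -/i h1 subSS.
  have := h2 j; repeat case: ifP; lia.
- move=> j; rewrite nth_insert_counter -/i.
  have := h2 j; repeat case: ifP; lia.
- move=> j; rewrite hs ht h3 !trap_diffE //= odd_double /= ev uphalf_double.
  by congr (_ + _); repeat case: ifP; lia.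
- split=> [|j].
    by rewrite hs ht h40 !trap_diffE //=; repeat case: ifP; lia.
  have := h4 j; rewrite !hs !ht !trap_diffE //= !odd_double /= !ev !uphalf_double.
  rewrite {hs ht h1 h2 h3 h5 hlt hi0 ti e1 e2 ev od}.
  case: (ltngtP j i) => ji; case: (ltngtP j.+1 i) => ji';
    case: (ltnP j k) => jk; case: (ltnP j.+1 k) => jk'; rewrite /=; lia.
- move=> j; rewrite hs trap_diffE // odd_double ev.
  have [r e] := h5 j; have := hlt j; rewrite e {e hs ht h1 h3 h4 h5 h40 ti e1 e2 ev od hlt}.
  case: (ltnP j k) => jk; last first.
    move=> _ hr; exists r; last by move: hr; repeat case: ifP; lia.
    by repeat case: ifP; lia.
  rewrite andbT; case: (ltngtP j i) => ji.
  (* Below [i] the entry rises by 1 and the counter falls by 1, so the remainder falls with it. *)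
  + move=> /(_ isT) c0; case: (ltnP j.*2 M) => [jM|]; last lia.
    move=> /andP[rM /eqP rE]; exists r.-1; first lia.
    rewrite nth_insert_counter -/i ji; have -> : (j < M)%N by lia.
    lia.
  + move=> _ hr; exists r; first lia.
    rewrite nth_insert_counter -/i; move: hr; repeat case: ifP; lia.
  (* At [i] the remainder was 0; with [T] up by 1 and the entry up by [k - i] it becomes
     [(M - 2 i) - (k - i) = M - k - i], the value to which the counter is set. *)
  + move=> _; case: (ltnP j.*2 M) => [jM|]; last lia.
    rewrite ji hi0 => /andP[rM /eqP ->]; exists (M - k - i)%N; first lia.
    rewrite nth_insert_counter -/i ltnn eqxx; repeat case: ifP; lia.
Qed.

Lemma geq_trans : transitive geq.
Proof. by move=> x y z /= xy yz; exact: leq_trans yz xy. Qed.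

Lemma coupled_foldl M k la : odd_partition M la ->
  all (fun p => 2 * k - 1 <= p)%N la ->
  exists T, coupled M k T (foldl (Phi_step M) (0, nseq M 0%N) la)
    (foldl (Phi_step M.+1) (0, nseq M.+1 0%N) [seq (p + 2)%N | p <- la]).
Proof.
elim/last_ind: la k => [|la p IH] k.
  move=> _ _; exists (fun=> 0); split=> /=.
  - by move=> j; rewrite -[0%N :: _]/(nseq M.+1 0%N) !nth_nseq !if_same.
  - by move=> j; rewrite nth_nseq if_same.
  - by [].
  - by split.
  - move=> j; exists 0%N; first by rewrite !mul0r.
    by rewrite nth_nseq if_same; case: ifP; rewrite ?eqxx ?implybT; lia.
rewrite /odd_partition /= /is_partition !all_rcons.
move=> -[/and3P[srt p0 pos] /andP[/andP[op pM] oddM]].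
move=> /andP[kp kla].
have srt' : pairwise geq (rcons la p).
  by rewrite -(sorted_pairwise geq_trans).
move: srt'; rewrite pairwise_rcons => /andP[ple srt'].
pose kp' := p.+1./2.
have pE : p = (2 * kp' - 1)%N by rewrite /kp'; lia.
(* All earlier parts are at least [p], so the threshold of [p] itself is available; it is lowered to
   [k] after the insertion. *)
have [||T hT] := IH kp'.
- by split=> //; rewrite /is_partition pos andbT (sorted_pairwise geq_trans).
- by rewrite -pE; apply: sub_all ple => x /=; lia.
have kp'M : (0 < kp' <= M)%N by rewrite /kp'; lia.
have [T' hT'] := coupled_step kp'M hT; exists T'.
rewrite map_rcons !foldl_rcons.
have -> : (p + 2 = 2 * kp' + 1)%N by lia.
rewrite pE; apply: coupled_le hT'; lia.
Qed.

(** * The rounded-up ratio and the reflection *)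

(* [f (2 j) / (M - 2 j)] rounded up; this is [0] for [M <= 2 j], where the
   truncated subtraction and the division by [0] both give [0]. *)
Definition ceil_ratio (M : nat) (f : nat -> int) (j : nat) : int :=
  - ((- f j.*2) %/ (M - j.*2)%N)%Z.

Lemma ceil_ratio_out M f j : (M <= j.*2)%N -> ceil_ratio M f j = 0.
Proof.
move=> Mj; rewrite /ceil_ratio; have -> : (M - j.*2 = 0)%N by lia.
by rewrite divz0 oppr0.
Qed.

Lemma ceil_ratioE M f j : (j.*2 < M)%N ->
  exists2 r : nat, f j.*2 = ceil_ratio M f j * (M - j.*2)%N%:Z - r%:Z &
                   (r < M - j.*2)%N.
Proof.
move=> jM; have n0 : ((M - j.*2)%N%:Z != 0) by lia.
have := divz_eq (- f j.*2) (M - j.*2)%N.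
have := modz_ge0 (- f j.*2) n0.
have := ltz_mod (- f j.*2) n0.
case: (modz _ _) => // r hr _ e.
exists r; last lia.
by rewrite /ceil_ratio mulNr -opprD -e opprK.
Qed.

Lemma ceil_ratio_uniq M f j (T : int) (r : nat) :
  f j.*2 = T * (M - j.*2)%N%:Z - r%:Z -> (r < M - j.*2)%N ->
  T = ceil_ratio M f j.
Proof.
move=> e hr; rewrite /ceil_ratio e opprB addrC -mulNr divzMDl; last lia.
by rewrite divz_small ?addr0 ?opprK //; lia.
Qed.

(* For a reduced or lecture hall sequence, [f (2 j) - ceil_ratio M f j] and
   [f (2 j + 2) + ceil_ratio M f (j + 1)] are the largest and the smallest value
   that the neighbours allow at the position [2 j + 1]. *)
Definition reflect_odd (M : nat) (f : nat -> int) : nat -> int :=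
  fun i => let j := i./2 in
    if odd i then f j.*2 - ceil_ratio M f j
                  + (f j.*2.+2 + ceil_ratio M f j.+1) - f i
    else f i.

Lemma reflect_odd_even M f j : reflect_odd M f j.*2 = f j.*2.
Proof. by rewrite /reflect_odd odd_double. Qed.

Lemma reflect_odd_odd M f j :
  reflect_odd M f j.*2.+1 = f j.*2 - ceil_ratio M f j
                  + (f j.*2.+2 + ceil_ratio M f j.+1) - f j.*2.+1.
Proof. by rewrite /reflect_odd /= odd_double /= uphalf_double. Qed.

Lemma ceil_ratio_reflect M f j :
  ceil_ratio M (reflect_odd M f) j = ceil_ratio M f j.
Proof. by rewrite /ceil_ratio reflect_odd_even. Qed.

Lemma nat_parity_ind (P : nat -> Prop) :
  (forall j, P j.*2) -> (forall j, P j.*2.+1) -> forall i, P i.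
Proof.
by move=> h0 h1 i; rewrite -(odd_double_half i); case: (odd i); [exact: h1 | exact: h0].
Qed.

Lemma reflect_oddK M : involutive (reflect_odd M).
Proof.
move=> f; apply/funext; apply: nat_parity_ind => j.
  by rewrite !reflect_odd_even.
rewrite reflect_odd_odd !ceil_ratio_reflect reflect_odd_odd.
by rewrite -doubleS !reflect_odd_even; ring.
Qed.

Lemma Phi_shift M la : odd_partition M la ->
  let f := Phi M la in let g := Phi M.+1 [seq (p + 2)%N | p <- la] in
  g 0%N = f 0%N + ceil_ratio M f 0 /\ (fun i => g i.+1) = reflect_odd M f.
Proof.
move=> hla f g.
(* Threshold 0 cuts the tie to the counter; for [2 j < M] what remains is [0 <= r < M - 2 j], which
   determines [T j]. *)
have [|T] := @coupled_foldl M 0 la hla; first by apply/allP.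
rewrite /coupled -/(Phi M la) -/(Phi M.+1 _) -/f -/g => -[_ _ h3 [h40 h4] h5].
have TE j : T j = ceil_ratio M f j.
  have [r e] := h5 j; case: ltnP => jM; first by move=> /andP[rM _]; exact: ceil_ratio_uniq e rM.
  by move=> /andP[_ /eqP ->]; rewrite ceil_ratio_out.
split; first by rewrite h40 TE.
apply/funext; apply: nat_parity_ind => j; first by rewrite reflect_odd_even h3.
by rewrite reflect_odd_odd -!TE -(h4 j) addrK.
Qed.

(** * Reduced sequences described by integer intervals *)

(** Lowering [f i] by [N - i] lowers the middle expression by [(N - i - 1) (N - i)], so the strict
    bound says that the lowered sequence breaks the inequality. At [i = N - 1] no inequality
    follows, hence the vanishing there. *)
Definition reduced_seq (N : nat) (f : nat -> int) : Prop :=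
  (forall i, (N <= i.+1)%N -> f i = 0) /\
  forall i, (i.+1 < N)%N ->
    0 <= (N - i.+1)%N%:Z * f i - (N - i)%N%:Z * f i.+1
      < (N - i.+1)%N%:Z * (N - i)%N%:Z.

(** The quotient of [m y + r] by [m] is [y], and both bounds are multiples of [m]. *)
Lemma euclid_range (m r : nat) (l y : int) : (r < m)%N ->
  (0 <= m%:Z * y + r%:Z < m%:Z * l) = (0 <= y < l).
Proof. by move=> rm; apply/idP/idP; nia. Qed.

(** Each inequality involves one even position. Writing the entry there as [c n - r], with [c] its
    rounded-up ratio to [n], makes the middle expression [n] times an integer plus [r], and
    [euclid_range] divides by [n]. *)
Lemma reduced_seqP M f :
  reduced_seq M f <->
  (forall i, (M <= i.+1)%N -> f i = 0) /\
  forall j, (j.*2.+1 < M)%N ->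
    0 <= f j.*2 - ceil_ratio M f j - f j.*2.+1 < (M - j.*2.+1)%N%:Z /\
    0 <= f j.*2.+1 - (f j.*2.+2 + ceil_ratio M f j.+1) < (M - j.*2.+1)%N%:Z.
Proof.
have range_eq (a b c d : int) : a = b -> c = d -> (0 <= a < c) = (0 <= b < d).
  by move=> -> ->.
have even_range j : (j.*2.+1 < M)%N ->
  (0 <= (M - j.*2.+1)%N%:Z * f j.*2 - (M - j.*2)%N%:Z * f j.*2.+1
      < (M - j.*2.+1)%N%:Z * (M - j.*2)%N%:Z) =
  (0 <= f j.*2 - ceil_ratio M f j - f j.*2.+1 < (M - j.*2.+1)%N%:Z).
  move=> jM; have [|r e rM] := @ceil_ratioE M f j; first lia.
  have re : r%:Z = ceil_ratio M f j * (M - j.*2)%N%:Z - f j.*2 by lia.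
  rewrite -[RHS](euclid_range _ _ rM) re.
  have -> : (M - j.*2.+1)%N%:Z = (M - j.*2)%N%:Z - 1 by lia.
  by apply: range_eq; ring.
have odd_range j : (j.*2.+2 < M)%N ->
  (0 <= (M - j.*2.+2)%N%:Z * f j.*2.+1 - (M - j.*2.+1)%N%:Z * f j.*2.+2
      < (M - j.*2.+2)%N%:Z * (M - j.*2.+1)%N%:Z) =
  (0 <= f j.*2.+1 - (f j.*2.+2 + ceil_ratio M f j.+1) < (M - j.*2.+1)%N%:Z).
  move=> jM; have [//|r e rM] := @ceil_ratioE M f j.+1; rewrite -doubleS.
  have re : r%:Z = ceil_ratio M f j.+1 * (M - j.+1.*2)%N%:Z - f j.+1.*2 by lia.
  rewrite -[RHS](euclid_range _ _ rM) re.
  have -> : (M - j.*2.+1)%N%:Z = (M - j.+1.*2)%N%:Z + 1 by lia.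
  by apply: range_eq; ring.
split=> -[h0 h]; split=> //.
  move=> j jM; split; first by rewrite -even_range //; exact: h.
  case: (ltnP j.*2.+2 M) => jM'; first by rewrite -odd_range //; exact: h.
  rewrite ceil_ratio_out ?h0 //; lia.
apply: nat_parity_ind => j jM.
  by rewrite even_range //; have [] := h j jM.
by rewrite odd_range //; have [|//] := h j; exact: ltnW.
Qed.

(** The reflection exchanges the two ranges of [reduced_seqP] at each odd position; both have length
    [M - 2 j - 1]. *)
Lemma reduced_reflect M f : reduced_seq M f -> reduced_seq M (reflect_odd M f).
Proof.
move=> /reduced_seqP[h0 h]; apply/reduced_seqP; split.
  apply: nat_parity_ind => j jM; first by rewrite reflect_odd_even h0.
  rewrite reflect_odd_odd [f j.*2.+1]h0 // [f j.*2.+2]h0; last lia.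
  rewrite (@ceil_ratio_out _ _ j.+1) // subr0 !addr0.
  (* It remains to see that [f (2 j)] equals its rounded-up ratio: for [M = 2 j + 2] the range has
     length 1, and for [M = 2 j + 1] the denominator is 1. *)
  case: (ltngtP j.*2.+2 M) => jM'; first lia; last first.
    have [|+ _] := h j; first lia.
    by rewrite [f j.*2.+1]h0 //; lia.
  case: (leqP M j.*2) => jM2; first by rewrite ceil_ratio_out // h0 //; lia.
  have [r -> rM] := @ceil_ratioE M f j jM2.
  have Mj : (M - j.*2 = 1)%N by lia.
  by rewrite Mj in rM *; lia.
move=> j jM; rewrite !ceil_ratio_reflect reflect_odd_odd -doubleS !reflect_odd_even.
have := h j jM; rewrite -doubleS; lia.
Qed.

(** Division with remainder at the second entry turns the first inequality into a range for the
    offset of [f 0] from its least value. *)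
Lemma reduced_seqS M f :
  reduced_seq M.+1 f <->
  reduced_seq M (fun i => f i.+1) /\
  0 <= f 0%N - (f 1%N + ceil_ratio M (fun i => f i.+1) 0) <= M%:Z.
Proof.
split=> [[h0 h]|[[h0 h] h1]].
  split.
    by split=> [i iM|i iM]; [exact: h0|exact: (h i.+1)].
  case: M h0 h => [|M] h0 h; first by rewrite ceil_ratio_out // !h0.
  have := h 0%N isT; have [//|r /= e rM] := @ceil_ratioE M.+1 (fun i => f i.+1) 0.
  move: e rM; rewrite double0 subn0 subSS subn0 => e rM.
  set c := ceil_ratio _ _ _ in e *.
  have -> : M.+1%:Z * f 0%N - M.+2%:Z * f 1%N = M.+1%:Z * (f 0%N - (f 1%N + c)) + r%:Z by lia.
  by rewrite euclid_range //; lia.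
split=> [[|i] iM|[|i] iM].
- have M0 : M = 0%N by lia.
  by move: h1; rewrite M0 ceil_ratio_out ?(h0 0%N) //; lia.
- exact: h0.
- have [//|r /= e rM] := @ceil_ratioE M (fun i => f i.+1) 0.
  move: e rM; rewrite double0 subn0 subSS subn0 => e rM.
  set c := ceil_ratio _ _ _ in e h1 *.
  have -> : M%:Z * f 0%N - M.+1%:Z * f 1%N = M%:Z * (f 0%N - (f 1%N + c)) + r%:Z by lia.
  by rewrite euclid_range //; lia.
- by rewrite !subSS; apply: h.
Qed.

(** * Splitting off the parts equal to 1 *)

(** For [k = 1] the trapezoid difference is [(1, 0, 0, ...)] at every index, whatever the
    counter. *)
Lemma Phi_cat_ones N s m i :
  Phi N (s ++ nseq m 1%N) i = Phi N s i + (if i == 0%N then m%:Z else 0).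
Proof.
elim: m s i => [|m IH] s i; first by rewrite cats0 if_same addr0.
rewrite -cat_rcons IH /Phi foldl_rcons /Phi_step /= fctE /first_zero trap_diffE //.
by case: i => [|[|i]] /=; repeat case: ifP; lia.
Qed.

Lemma partition_split_ones s : is_partition s ->
  s = [seq p <- s | 2 <= p]%N ++ nseq (count_mem 1%N s) 1%N.
Proof.
rewrite /is_partition (sorted_pairwise geq_trans).
elim: s => // p s IH /= /andP[/andP[ps srt] /andP[p0 pos]].
case: (ltnP 1 p) => hp.
  by rewrite gtn_eqF //= {1}IH ?srt.
have p1 : p = 1%N by lia.
rewrite p1 /= in ps *.
have s1 : all (pred1 1%N) s.
  by apply/allP => x xs; have := allP ps x xs; have := allP pos x xs; rewrite /=; lia.
have -> : [seq q <- s | 1 < q]%N = [::].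
  apply/eqP; rewrite -[_ == _]negbK -has_filter; apply/hasPn => x /(allP s1) /=; lia.
have -> : count_mem 1%N s = size s by apply/eqP; rewrite -all_count.
by rewrite cat0s; congr cons; apply/all_pred1P.
Qed.

(** The multiplicity bounds match: [(M + 1) - (k + 1) = M - k] for the shifted parts, and
    [(M + 1) - 1 = M] for the part 1. *)
Lemma reduced_odd_partition_cat M la m :
  reduced_odd_partition M la -> (m <= M)%N ->
  reduced_odd_partition M.+1 ([seq (p + 2)%N | p <- la] ++ nseq m 1%N).
Proof.
rewrite /reduced_odd_partition /odd_partition /= /is_partition.
rewrite !(sorted_pairwise geq_trans) => -[[/andP[srt pos] od] cnt] mM.
split; first split.
- rewrite pairwise_cat all_cat -andbA; apply/and4P; split; last 2 first.
  + by rewrite all_map; apply/allP => x _ /=; lia.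
  + by apply/allP => x /nseqP[-> _].
  + by apply/allrelP => x y /mapP[z _ ->] /nseqP[-> _] /=; lia.
  + rewrite pairwise_map; apply/andP; split.
      by apply: sub_pairwise srt => x y /=; lia.
    by elim: m {mM} => //= m ->; rewrite andbT; apply/allP => x /nseqP[-> _].
- rewrite all_cat all_map; apply/andP; split.
    by apply: sub_all od => x /= /andP[ox xM]; lia.
  by apply/allP => x /nseqP[-> _] /=; lia.
- move=> [//|[|k]] kM; rewrite count_cat count_map count_nseq /=.
    rewrite mul1n (eq_in_count (a2 := pred0)) ?count_pred0; first lia.
    by move=> x _ /=; lia.
  rewrite (eq_in_count (a2 := pred1 (2 * k.+1 - 1)%N)); last by move=> x _ /=; lia.
  have := cnt k.+1; have -> : (1 == 2 * k.+2 - 1)%N = false by lia.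
  rewrite /=; lia.
Qed.

Lemma reduced_odd_partition_split M la : reduced_odd_partition M.+1 la ->
  exists2 la', reduced_odd_partition M la' &
  exists2 m, (m <= M)%N & la = [seq (p + 2)%N | p <- la'] ++ nseq m 1%N.
Proof.
move=> [[par od] cnt].
have laE := partition_split_ones par.
have fE : [seq p <- la | 2 <= p]%N =
    [seq (p + 2)%N | p <- [seq (p - 2)%N | p <- la & (2 <= p)%N]].
  rewrite -map_comp map_id_in // => x; rewrite mem_filter /= => /andP[x2 _]; lia.
exists [seq (p - 2)%N | p <- la & (2 <= p)%N]; last first.
  exists (count_mem 1%N la); last by rewrite -fE.
  by have := cnt 1%N isT; rewrite [(M.+1 - _)%N]subn1.
move: par; rewrite /is_partition => /andP[srt pos].
split; first split.
- apply/andP; split.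
    move: srt; rewrite !(sorted_pairwise geq_trans) pairwise_map => srt.
    apply: sub_pairwise (pairwise_filter _ srt) => x y /=; lia.
  rewrite all_map; apply/allP => x; rewrite mem_filter => /andP[x2 /(allP od)] /=; lia.
- rewrite all_map; apply/allP => x; rewrite mem_filter => /andP[x2 /(allP od)] /=; lia.
- move=> k kM; have := cnt k.+1; rewrite count_map count_filter.
  rewrite (eq_count (a2 := pred1 (2 * k.+1 - 1)%N)); first lia.
  move=> x /=; lia.
Qed.

(** * Induction on the width *)

Lemma Phi_bij M :
  set_bij (reduced_odd_partition M) (reduced_seq M) (Phi M).
Proof.
elim: M => [|M [IHf IHi IHs]].
  have nil_only la : reduced_odd_partition 0 la -> la = [::].
    by case: la => // p la [[_ /=]]; lia.
  have Phi0 : Phi 0 [::] = 0 by [].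
  split.
  - by move=> la /nil_only ->; rewrite Phi0.
  - by move=> x y /set_mem/nil_only x0 /set_mem/nil_only y0 _; rewrite x0 y0.
  - move=> f [f0 _]; exists [::]; first by split=> //; split.
    by rewrite Phi0; apply/funext => i; rewrite f0.
have ones_head la m : odd_partition M la ->
    let g := Phi M.+1 ([seq (p + 2)%N | p <- la] ++ nseq m 1%N) in
    (fun i => g i.+1) = reflect_odd M (Phi M la) /\
    g 0%N - (g 1%N + ceil_ratio M (fun i => g i.+1) 0) = m%:Z.
  move=> ola g; have [g0 gS] := Phi_shift ola.
  have gE : (fun i => g i.+1) = reflect_odd M (Phi M la).
    by rewrite -gS; apply/funext => i; rewrite /g Phi_cat_ones addr0.
  split=> //; rewrite gE ceil_ratio_reflect.
  have -> : g 1%N = Phi M la 0%N by rewrite -[g 1%N]/((fun i => g i.+1) 0%N) gE.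
  rewrite /g Phi_cat_ones g0 /=; lia.
split.
- move=> _ /reduced_odd_partition_split[la hla [m mM ->]].
  have [gE hm] := ones_head la m hla.1.
  apply/reduced_seqS; rewrite gE; split; first by apply: reduced_reflect; exact: IHf.
  by rewrite -gE hm; lia.
- move=> x y /set_mem/reduced_odd_partition_split[la hla [m mM ->]].
  move=> /set_mem/reduced_odd_partition_split[la' hla' [m' m'M ->]] e.
  have [gE hm] := ones_head la m hla.1; have [gE' hm'] := ones_head la' m' hla'.1.
  (* The offset of the first entry gives [m = m'], and undoing the reflection gives
     [Phi M la = Phi M la']. *)
  move: hm gE; rewrite e hm' gE' => -[->] /(can_inj (@reflect_oddK M)) ee.
  by rewrite (IHi la la') ?inE.
- move=> f /reduced_seqS[fS /andP[m0 mM]].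
  (* The involution forces [Phi M la] to be the reflected tail of [f], and [m] to be the offset of
     [f 0]. *)
  have [la hla laE] := IHs _ (reduced_reflect fS).
  pose m := absz (f 0%N - (f 1%N + ceil_ratio M (fun i => f i.+1) 0))%R.
  exists ([seq (p + 2)%N | p <- la] ++ nseq m 1%N).
    by apply: reduced_odd_partition_cat => //; rewrite /m; lia.
  have [gE hm] := ones_head la m hla.1.
  rewrite laE reflect_oddK in gE.
  have gSE i : Phi M.+1 ([seq (p + 2)%N | p <- la] ++ nseq m 1%N) i.+1 = f i.+1.
    by rewrite -[LHS]/((fun i => Phi M.+1 _ i.+1) i) gE.
  apply/funext => -[|i] //; move: hm; rewrite gE gSE /m; lia.
Qed.

(** * Lecture hall partitions as integer sequences *)

Definition lecture_hall_seq (N : nat) (f : nat -> int) : Prop :=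
  [/\ forall i, 0 <= f i, forall i, (N <= i)%N -> f i = 0 &
      forall i, (i.+1 < N)%N -> (N - i)%N%:Z * f i.+1 <= (N - i.+1)%N%:Z * f i].

(** The inequalities force a weak decrease, so a nonnegative [f] is positive before its first zero
    [l] and vanishes from there on; cutting at [l] gives the partition. *)
Lemma image_lecture_hall N :
  zseq @` lecture_hall N = lecture_hall_seq N.
Proof.
have ratio_le (a b n m : nat) : (0 < n)%N -> (0 < m)%N ->
    ((a%:R / n%:R <= b%:R / m%:R :> rat) = (m%:Z * a%:Z <= n%:Z * b%:Z)).
  move=> n0 m0.
  rewrite ler_pdivrMr ?ltr0n // mulrAC ler_pdivlMr ?ltr0n //.
  by rewrite -!natrM ler_nat -!PoszM lez_nat mulnC (mulnC b).
apply/seteqP; split=> [_ [mu [par szN lh] <-]|f [f0 fN flh]].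
  split=> [i|i iN|i iN]; rewrite /zseq //; first by rewrite nth_default //; lia.
  case: (ltnP i.+1 (size mu)) => isz; last by rewrite (nth_default _ isz) mulr0 mulr_ge0.
  by rewrite -ratio_le ?lh //; lia.
have fdec i : f i.+1 <= f i.
  case: (ltnP i.+1 N) => iN; last by rewrite fN.
  have := flh i iN; have := f0 i; have := f0 i.+1; nia.
have fmono i j : (i <= j)%N -> f j <= f i.
  move=> /subnK <-; elim: (j - i)%N => // k ih.
  exact: le_trans (fdec _) ih.
pose l := find (fun i => f i == 0) (iota 0 N).
have lN : (l <= N)%N by rewrite -[X in (_ <= X)%N](size_iota 0); exact: find_size.
have f_lt i : (i < l)%N -> 0 < f i.
  move=> il; rewrite lt_neqAle f0 andbT eq_sym.
  by have := before_find 0%N il; rewrite nth_iota ?add0n => [->//|]; exact: leq_trans il lN.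
have f_ge i : (l <= i)%N -> f i = 0.
  move=> li; have fl : f l = 0.
    case: (ltnP l N) => [lN'|]; last exact: fN.
    have := @nth_find _ 0%N (fun i => f i == 0) (iota 0 N).
    by rewrite has_find size_iota nth_iota // => /(_ lN') /eqP.
  by apply/eqP; rewrite eq_le f0 andbT -fl fmono.
have zE : zseq [seq absz (f i) | i <- iota 0 l] = f.
  apply/funext => i; rewrite /zseq; case: (ltnP i l) => il.
    by rewrite (nth_map 0%N) ?size_iota // nth_iota // gez0_abs.
  by rewrite nth_default ?size_map ?size_iota // f_ge.
exists [seq absz (f i) | i <- iota 0 l] => //; split.
- apply/andP; split.
    rewrite (sorted_pairwise geq_trans) pairwise_map.
    rewrite -(sorted_pairwise (leT := fun x y => absz (f y) <= absz (f x))%N).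
      case: l {f_lt f_ge zE lN} => // l /=; elim: l 0%N => //= l ih k.
      by rewrite ih andbT; have := fdec k; have := f0 k; have := f0 k.+1; lia.
    by move=> x y z /= xy yz; exact: leq_trans yz xy.
  rewrite all_map; apply/allP => i; rewrite mem_iota add0n => /f_lt /=; lia.
- by rewrite size_map size_iota.
- rewrite size_map size_iota => i il.
  rewrite ratio_le; [|lia|lia].
  have nE j : (nth 0%N [seq absz (f i) | i <- iota 0 l] j)%:Z = f j.
    by rewrite -[in RHS]zE.
  by rewrite !nE; apply: flh; lia.
Qed.

Lemma image_reduced_lecture_hall N :
  zseq @` reduced_lecture_hall N = reduced_seq N.
Proof.
have zsize mu i : lecture_hall N mu -> (i < size mu)%N = (zseq mu i != 0).
  move=> [/andP[_ /allP pos] _ _]; rewrite /zseq; case: ltnP => h.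
    by have := pos _ (mem_nth 0%N h); rewrite /=; lia.
  by rewrite nth_default.
have lowerE mu i : lower_entry N mu i =
    fun j => zseq mu j - (if j == i then (N - i)%N%:Z else 0).
  by apply/funext => j; rewrite /lower_entry; case: eqP; rewrite ?subr0.
apply/seteqP; split=> [_ [mu [lmu red] <-]|f [fN fr]].
  have : (zseq @` lecture_hall N) (zseq mu) by exists mu.
  rewrite image_lecture_hall => -[f0 fN flh].
  move: red; rewrite image_lecture_hall => red.
  have red' i : zseq mu i != 0 -> ~ lecture_hall_seq N (lower_entry N mu i).
    by rewrite -zsize //; exact: red.
  rewrite {red}; set f := zseq mu in red' f0 fN flh *.
  have key i : (i < N)%N -> (N - i)%N%:Z <= f i ->
      ~ ((i.+1 < N)%N -> (N - i)%N%:Z * f i.+1 <= (N - i.+1)%N%:Z * (f i - (N - i)%N%:Z)).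
    move=> iN fi fi'; apply: (red' i); first by lia.
    rewrite lowerE -/f; split=> j.
    - by case: eqP => [->|_]; rewrite ?subr0 ?subr_ge0.
    - by move=> jN; rewrite fN //; case: eqP; lia.
    (* Lowering the entry [i] only relaxes the inequality with the entry before it. *)
    - move=> jN; case: (j.+1 =P i) => [ji|nji].
        have -> : (j == i) = false by lia.
        have := flh j jN; rewrite ji subr0; nia.
      rewrite subr0; case: (j =P i) => [ji|_]; first by rewrite ji in jN *; apply: fi'.
      by rewrite subr0; exact: flh.
  split=> [i iN|i iN].
    case: (ltnP i N) => [iN'|]; last exact: fN.
    have iE : i = N.-1 by lia.
    (* At the last position no inequality follows, so a positive entry could be lowered by
       [N - i = 1]. *)
    have [fi|] := leP 1 (f i); last by have := f0 i; lia.
    case: (key i) => //; first lia.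
    lia.
  apply/andP; split; first by rewrite subr_ge0; exact: flh.
  rewrite ltNge; apply/negP => h; apply: (key i); [lia| |].
    have := f0 i.+1; nia.
  move=> _; nia.
(* Descending induction on the position, starting from the zero at [N - 1]. *)
have f0 i : 0 <= f i.
  have [d hd] := ubnP (N - i)%N; elim: d i hd => // d ih i hd.
  case: (ltnP i.+1 N) => iN; last by rewrite fN.
  have /andP[+ _] := fr i iN; have := ih i.+1; nia.
have : lecture_hall_seq N f.
  split=> // [i iN|i iN]; first by apply: fN; exact: leqW.
  by have /andP[+ _] := fr i iN; rewrite subr_ge0.
rewrite -image_lecture_hall => -[mu lmu fE]; exists mu => //; split=> // i.
rewrite zsize // fE image_lecture_hall lowerE fE => fi [_ _ /(_ i)].
have iN : (i.+1 < N)%N by rewrite ltnNge; apply/negP => Ni; rewrite fN ?eqxx in fi.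
rewrite eqxx => /(_ iN); have /andP[_] := fr i iN.
have -> : (i.+1 == i) = false by lia.
rewrite subr0; nia.
Qed.

Unset Implicit Arguments.

Theorem mainTheorem4 (N : nat) (hN : (0 < N)%N) :
  set_bij (reduced_odd_partition N) (zseq @` reduced_lecture_hall N) (Phi N).
Proof. by rewrite image_reduced_lecture_hall; exact: Phi_bij. Qed.
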